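(* Let $p \in (1,\infty)$, $\lambda > 0$, and let $(X_n)_{n\in\mathbb N}$ be a sequence of Banach spaces each having property $\lambda$-HIC$_{p,d}$. Let $E$ be a reflexive Banach space with a normalized $1$-unconditional basis $(e_n)_{n\in\mathbb N}$ which is $p$-convex with convexity constant $1$. Then $X = \left(\sum_{n\in\mathbb N} X_n\right)_E$ has property $(\lambda+2+\varepsilon)$-HIC$_{p,d}$ for every $\varepsilon > 0$.
   Context: Hamming graphs: for an infinite $\mathbb M \subseteq \mathbb N$ and $k\in\mathbb N$, $[\mathbb M]^k$ is the set of $k$-tuples $\bar n=(n_1,\dots,n_k)$ of elements of $\mathbb M$ with $n_1<\dots<n_k$, equipped with the Hamming distance $d_{\mathbb H}(\bar n,\bar m)=|\{j : n_j\neq m_j\}|$; $[\mathbb M]^\omega$ denotes the set of infinite subsets of $\mathbb M$. $I_k(\mathbb M)=\{(\bar n,\bar m)\in[\mathbb M]^k\times[\mathbb M]^k : n_1<m_1<n_2<m_2<\dots<n_k<m_k\}$. For $1\le j\le k$, $H_j(\mathbb M)=\{(\bar n,\bar m)\in[\mathbb M]^k\times[\mathbb M]^k: n_i=m_i \text{ for all } i\neq j,\ n_j<m_j\}$. Property $\lambda$-HIC$_{p,d}$ (for a metric space $(M,d)$, $p\in(1,\infty)$, $\lambda>0$): for every $k\in\mathbb N$ and every Lipschitz $f:([\mathbb N]^k,d_{\mathbb H})\to M$ there is $\mathbb M\in[\mathbb N]^\omega$ with $d(f(\bar n),f(\bar m))\le \lambda\left(\sum_{j=1}^k\alpha_j^p\right)^{1/p}$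 for all $(\bar n,\bar m)\in I_k(\mathbb M)$, where $\alpha_j=\sup_{(\bar n,\bar m)\in H_j(\mathbb N)} d(f(\bar n),f(\bar m))$. Sums: for a $1$-unconditional basis $(e_n)$ of $E$, $\left(\sum_n X_n\right)_E$ is the Banach space of sequences $(x_n)$ with $x_n\in X_n$ such that $\sum_n\|x_n\|e_n$ converges in $E$, normed by $\|(x_n)\|=\|\sum_n \|x_n\|_{X_n} e_n\|_E$. A $1$-unconditional basis $(e_n)$ of $E$ is $p$-convex with convexity constant $1$ if $\left\|\sum_j \left(|x^1_j|^p+\dots+|x^k_j|^p\right)^{1/p} e_j\right\|^p\le \sum_{n=1}^k\|x^n\|^p$ for all $k$ and all $x^n=\sum_j x^n_j e_j\in E$. *)

(* Defs.v *)
From HB Require Import structures.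
From mathcomp Require Import all_boot all_order all_algebra.
From mathcomp Require Import all_classical all_reals all_analysis.
Set Implicit Arguments. Unset Strict Implicit. Unset Printing Implicit Defensive.
Import Order.TTheory GRing.Theory Num.Theory.
Import numFieldNormedType.Exports.
Local Open Scope classical_set_scope.
Local Open Scope ring_scope.

Definition incr (k : nat) (n : 'I_k -> nat) : Prop :=
  forall i j : 'I_k, (i < j)%N -> (n i < n j)%N.

Definition in_Hamming (k : nat) (M : set nat) (n : 'I_k -> nat) : Prop :=
  incr n /\ forall i, M (n i).

Definition dH (k : nat) (n m : 'I_k -> nat) : nat :=
  #|[set i : 'I_k | n i != m i]%SET|.

Definition interlaced (k : nat) (M : set nat) (n m : 'I_k -> nat) : Prop :=
  in_Hamming M n /\ in_Hamming M m /\
  (forall i : 'I_k, (n i < m i)%N) /\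
  (forall i j : 'I_k, (i.+1 = j)%N -> (m i < n j)%N).

Definition H_pair (k : nat) (M : set nat) (j : 'I_k) (n m : 'I_k -> nat) : Prop :=
  in_Hamming M n /\ in_Hamming M m /\
  (forall i : 'I_k, i != j -> n i = m i) /\ (n j < m j)%N.

Definition lipschitz_H {R : realType} (T : Type) (d : T -> T -> R) (k : nat)
  (f : ('I_k -> nat) -> T) : Prop :=
  exists L : R, forall n m, in_Hamming setT n -> in_Hamming setT m ->
    d (f n) (f m) <= L * (dH n m)%:R.

Definition alpha {R : realType} (T : Type) (d : T -> T -> R) (k : nat)
  (f : ('I_k -> nat) -> T) (j : 'I_k) : R :=
  sup [set r | exists n m, H_pair setT j n m /\ r = d (f n) (f m)].

Definition HIC {R : realType} (p lambda : R) (T : Type) (d : T -> T -> R) : Prop :=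
  forall (k : nat) (f : ('I_k -> nat) -> T), lipschitz_H d f ->
    exists M : set nat, infinite_set M /\
      forall n m, interlaced M n m ->
        d (f n) (f m) <= lambda * (\sum_(j < k) (alpha d f j) `^ p) `^ p^-1.

Definition normdist {R : realType} (V : normedModType R) (x y : V) : R := `|x - y|.

Definition bdd_lin {R : realType} (E : normedModType R) (f : E -> R) : Prop :=
  (forall (a : R) (x y : E), f (a *: x + y) = a * f x + f y) /\
  exists C : R, forall x, `|f x| <= C * `|x|.

Definition opnorm {R : realType} (E : normedModType R) (f : E -> R) : R :=
  sup [set r | exists x : E, `|x| <= 1 /\ r = `|f x|].

Definition reflexive_space {R : realType} (E : normedModType R) : Prop :=
  forall Phi : (E -> R) -> R,
    (forall (a : R) (f g : E -> R), bdd_lin f -> bdd_lin g ->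
        Phi (fun x => a * f x + g x) = a * Phi f + Phi g) ->
    (exists C : R, forall f, bdd_lin f -> `|Phi f| <= C * opnorm f) ->
    exists x : E, forall f, bdd_lin f -> Phi f = f x.

Definition expands {R : realType} (E : normedModType R) (e : nat -> E)
  (a : nat -> R) (x : E) : Prop :=
  series (fun i => a i *: e i) n @[n --> \oo] --> x.

Definition schauder_basis {R : realType} (E : normedModType R) (e : nat -> E) : Prop :=
  forall x : E, exists! a : nat -> R, expands e a x.

Definition normalized {R : realType} (E : normedModType R) (e : nat -> E) : Prop :=
  forall n, `|e n| = 1.

Definition one_unconditional_basis {R : realType} (E : normedModType R)
  (e : nat -> E) : Prop :=
  schauder_basis e /\
  forall (N : nat) (a : nat -> R) (s : nat -> bool),
    `|\sum_(i < N) (((-1) ^+ s i) * a i) *: e i| <= `|\sum_(i < N) a i *: e i|.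

Definition p_convex1 {R : realType} (p : R) (E : normedModType R) (e : nat -> E) : Prop :=
  forall (k : nat) (x : 'I_k -> E) (c : 'I_k -> nat -> R) (y : E),
    (forall n, expands e (c n) (x n)) ->
    expands e (fun j => (\sum_(n < k) `|c n j| `^ p) `^ p^-1) y ->
    `|y| `^ p <= \sum_(n < k) `|x n| `^ p.

Definition in_sumE {R : realType} (X : nat -> normedModType R)
  (E : normedModType R) (e : nat -> E) (x : forall n, X n) : Prop :=
  cvgn (series (fun n => `|x n| *: e n)).

Definition sumE {R : realType} (X : nat -> normedModType R)
  (E : normedModType R) (e : nat -> E) : Type :=
  {x : forall n, X n | in_sumE e x}.

Definition sumE_dist {R : realType} (X : nat -> normedModType R)
  (E : normedModType R) (e : nat -> E) (x y : sumE X e) : R :=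
  `| limn (series (fun n => `|proj1_sig x n - proj1_sig y n| *: e n)) |.

(* Main.v *)
Require Import Defs.
From HB Require Import structures.
From mathcomp Require Import all_boot all_order all_algebra.
From mathcomp Require Import all_classical all_reals all_analysis.
From mathcomp Require Import ring lra zify.
Set Implicit Arguments.
Unset Strict Implicit.
Unset Printing Implicit Defensive.
Import Order.TTheory GRing.Theory Num.Theory.
Import numFieldNormedType.Exports.
Local Open Scope classical_set_scope.
Local Open Scope ring_scope.

(** Write [S = (sum_j alpha_j^p)^(1/p)] and [G n = (|f_i n|)_i], a map into [E]
    that is at most as oscillating as [f]. Iterated limits of [G] along a free
    ultrafilter, one index of the tuple at a time from the last to the first,
    stay in [E] by reflexivity and form a tree whose successive increments have
    norm at most [alpha_j] and tend to [0] coordinatewise. A gliding hump and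
    [p]-convexity then give a coordinate [n0] beyond which
    [|G n| <= S + delta] for all tuples [n] in some infinite set, so the part of
    [f n - f m] beyond [n0] contributes at most [2 S + 2 delta].
    On the finitely many coordinates [i < n0], a Ramsey argument makes
    [|f_i n - f_i m|] almost constant on each [H_j], hence
    [|sum_i alpha_j(f_i) e_i| <= alpha_j + delta]; applying the hypothesis to
    each [X_i] in turn and [p]-convexity again, this part contributes at most
    [lambda (S + delta)]. *)

Lemma cvg_norm_le (R : realType) (V : normedModType R) (T : Type)
  (F : set_system T) {FF : ProperFilter F} (f : T -> V) (y : V) (C : R) :
  f t @[t --> F] --> y -> (\forall t \near F, `|f t| <= C) -> `|y| <= C.
Proof.
by move=> /cvg_norm fy fC; exact: cvgr_to_le fy fC.
Qed.

(** * Ultrafilter limits and Ramsey-type selection *)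

Section UltrafilterCombinatorics.
Variables (R : realType) (U : set_system nat).
Hypotheses (UU : UltraFilter U) (Uoo : \oo `<=` U).

Local Instance U_proper : ProperFilter U := @ultra_proper _ _ UU.

Lemma ultra_fmap (T : Type) (a : nat -> T) : UltraFilter (a @ U).
Proof.
split; first exact: fmap_proper_filter.
move=> G GP sG; apply/seteqP; split=> // A GA.
have [//|UC] := in_ultra_setVsetC (a @^-1` A) UU.
have /sG GC : (a @ U) (~` A) by [].
have G0 : G set0 by rewrite -(setICr A); exact: filterI.
by have := @filter_not_empty _ _ GP G0.
Qed.

Definition limU (a : nat -> R) : R := lim (a @ U).

(** [limU] is a genuine limit only along bounded values: the image of [U] is again an ultrafilter,
    and it contains the compact interval [[-C, C]]. *)
Lemma cvg_limU (a : nat -> R) (C : R) :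
  (\forall t \near U, `|a t| <= C) -> a t @[t --> U] --> limU a.
Proof.
move=> aC.
have := @segment_compact R (- C) C; rewrite compact_ultra => /(_ (a @ U)).
have UaU := ultra_fmap a.
have aI : (a @ U) `[(- C), C]%classic.
  by apply: filterS aC => t; rewrite /= in_itv /= -ler_norml.
by move=> /(_ UaU aI)[l [_ al]]; exact: (cvgP l al).
Qed.

Lemma limU_le (a : nat -> R) (C : R) :
  (\forall t \near U, `|a t| <= C) -> `|limU a| <= C.
Proof.
by move=> aC; exact: cvg_norm_le (cvg_limU aC) aC.
Qed.

Lemma ultra_gt (n : nat) : \forall t \near U, (n < t)%N.
Proof. by apply: Uoo; exact: nbhs_infty_gt. Qed.

(** A list [s] is a node of a tree and [m] counts the entries still to be appended, so the last
    entry of a tuple carries the innermost limit. *)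
Fixpoint Llim (m : nat) (v : seq nat -> R) (s : seq nat) : R :=
  if m is m'.+1 then limU (fun t => Llim m' v (rcons s t)) else v s.

Lemma Llim_le (C : R) m v s : (forall s, `|v s| <= C) -> `|Llim m v s| <= C.
Proof.
move=> vC; elim: m s => //= m IH s; apply: limU_le.
by apply: nearW => t; exact: IH.
Qed.

Lemma cvg_Llim (C : R) m v s : (forall s, `|v s| <= C) ->
  Llim m v (rcons s t) @[t --> U] --> Llim m.+1 v s.
Proof.
move=> vC; apply: (@cvg_limU _ C); apply: nearW => t; exact: Llim_le.
Qed.

(** Membership in the [m]-fold Fubini product of [U], read off at the node [s]. *)
Fixpoint Uall (m : nat) (P : seq nat -> Prop) (s : seq nat) : Prop :=
  if m is m'.+1 then \forall t \near U, Uall m' P (rcons s t) else P s.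

Lemma Uall_inv (k : nat) (Inv : seq nat -> Prop) :
  Inv [::] ->
  (forall s, (size s < k)%N -> Inv s -> \forall t \near U, Inv (rcons s t)) ->
  Uall k Inv [::].
Proof.
move=> Inv0 InvS.
suff H m s : (size s + m = k)%N -> Inv s -> Uall m Inv s by exact: H.
elim: m s => //= m IH s sk Is.
have : (size s < k)%N by lia.
move=> /InvS /(_ Is); apply: filterS => t It.
by apply: IH => //; rewrite size_rcons; lia.
Qed.

(** Only finitely many lists have bounded length and bounded entries, so finitely many members of
    [U] are intersected. *)
Lemma near_all_seq (m a : nat) (Q : seq nat -> nat -> Prop) :
  (forall s, \forall t \near U, Q s t) ->
  \forall t \near U, forall s, (size s <= m)%N -> all (fun i => (i <= a)%N) s -> Q s t.
Proof.
elim: m Q => [|m IH] Q HQ.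
  by apply: filterS (HQ [::]) => t Qt [|].
have H1 : \forall t \near U, forall x : 'I_a.+1, forall s, (size s <= m)%N ->
    all (fun i => (i <= a)%N) s -> Q (val x :: s) t.
  by apply: filter_forall => x; apply: (IH (fun s => Q (val x :: s))).
apply: filterS2 (HQ [::]) H1 => t Q0 QS [//|x s] /= sm /andP[xa sa].
have xa' : (x < a.+1)%N by [].
exact: (QS (Ordinal xa')).
Qed.

Lemma diagonal_sequence (Q : nat -> nat -> Prop) :
  (forall a, \forall t \near U, Q a t) ->
  exists phi : nat -> nat, Q 0%N (phi 0%N) /\ forall i, Q (phi i) (phi i.+1).
Proof.
move=> HQ.
have /choice[nxt Hn] : forall a, exists t, Q a t.
  by move=> a; exact: (filter_ex (HQ a)).
by exists (fun i => iter i.+1 nxt 0%N); split=> [|i] /=; exact: Hn.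
Qed.

Lemma sorted_rcons_ltn s (t : nat) :
  sorted ltn (rcons s t) = sorted ltn s && all (fun x => (x < t)%N) s.
Proof.
have tr : transitive ltn by move=> ? ? ?; exact: ltn_trans.
by rewrite !(sorted_pairwise tr) pairwise_rcons andbC.
Qed.

(** Each new term is chosen to extend at once every good list whose entries are bounded by the
    previous term. By induction every increasing list of chosen terms is then good. *)
Lemma Uall_subsequence (k : nat) (P : seq nat -> Prop) : Uall k P [::] ->
  exists phi : nat -> nat, {homo phi : i j / (i < j)%N} /\
    forall s, sorted ltn s -> size s = k -> P (map phi s).
Proof.
move=> UP.
pose Good s := Uall (k - size s) P s.
pose Q a t := (a < t)%N /\ forall s, (size s <= k)%N -> all (fun i => (i <= a)%N) s ->
  (size s < k)%N -> Good s -> Good (rcons s t).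
have [phi [phi0 phiS]] : exists phi : nat -> nat, Q 0%N (phi 0%N) /\
    forall i, Q (phi i) (phi i.+1).
  apply: diagonal_sequence => a; apply: filterI (ultra_gt a) _.
  apply: near_all_seq => s; case: (ltnP (size s) k) => sk; last exact: nearW.
  case: (pselect (Good s)) => Gs; last by apply: nearW.
  move: (Gs); rewrite /Good; case E: (k - size s)%N => [|m] /=; first by lia.
  apply: filterS => t Ht _ _; rewrite size_rcons.
  by have -> : (k - (size s).+1 = m)%N by lia.
have phi_lt : {homo phi : i j / (i < j)%N}.
  apply: homo_ltn => [? ? ?|i]; first exact: ltn_trans.
  by case: (phiS i).
exists phi; split=> // s ss sk.
suff H : forall s, sorted ltn s -> (size s <= k)%N -> Good (map phi s).
  by have := H s ss; rewrite /Good size_map sk subnn; apply.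
elim/last_ind => [|{ss sk}s t IH]; first by rewrite /Good subn0.
rewrite sorted_rcons_ltn size_rcons map_rcons => /andP[ss /allP st] sk.
have Gs := IH ss (ltnW sk).
have phi_le i j : (i <= j)%N -> (phi i <= phi j)%N.
  by rewrite leq_eqVlt => /predU1P[->//|/phi_lt/ltnW].
(* If [t = 0], then [s] is empty and the initial condition [Q 0 (phi 0)] serves; otherwise the
   predecessor of [t] bounds all entries of [s]. *)
have [a Qa sa] : exists2 a, Q a (phi t) & all (fun i => (i <= a)%N) (map phi s).
  case: t st => [|t] st; last first.
    exists (phi t) => //; apply/allP => _ /mapP[x /st xt ->]; exact: phi_le.
  by exists 0%N => //; case: s st {ss sk Gs IH} => // x s /(_ x); rewrite inE eqxx => /(_ isT).
case: Qa => _; apply => //; rewrite size_map //; exact: ltnW.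
Qed.

(** A Ramsey theorem for finitely many bounded real-valued colourings: the values on selected lists
    all stay near the iterated limit [Llim k (v x) [::]]. *)
Lemma Ramsey_bounded (k : nat) (T : finType) (v : T -> seq nat -> R) (C d : R) :
  0 < d -> (forall x s, `|v x s| <= C) ->
  exists phi : nat -> nat, {homo phi : i j / (i < j)%N} /\
    forall x s s', sorted ltn s -> sorted ltn s' -> size s = k -> size s' = k ->
      `|v x (map phi s) - v x (map phi s')| <= d.
Proof.
move=> d0 vC.
(* Each appended entry drifts by at most [e], so a list of length [k] ends within [d / 2] of the
   iterated limit. *)
pose e := d / 2 / k.+1%:R.
have e0 : 0 < e by rewrite !divr_gt0.
pose Inv s := forall x,
  `|Llim (k - size s) (v x) s - Llim k (v x) [::]| <= (size s)%:R * e.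
have UI : Uall k Inv [::].
  apply: Uall_inv => [x|s sk Is]; first by rewrite subn0 subrr normr0 mul0r.
  apply: filter_forall => x.
  have /cvgrPdist_lt /(_ e e0) := @cvg_Llim C (k - (size s).+1) (v x) s (vC x).
  apply: filterS => t; rewrite size_rcons -natr1 mulrDl mul1r.
  have -> : (k - (size s).+1).+1 = (k - size s)%N by lia.
  move=> /ltW Ht; rewrite -(subrKA (Llim (k - size s) (v x) s)).
  by rewrite (le_trans (ler_normD _ _))// addrC lerD// distrC.
have [phi [phi_lt phiP]] := Uall_subsequence UI.
exists phi; split=> // x s s' ss ss' sk sk'.
have ke : k%:R * e <= d / 2.
  rewrite /e mulrCA ler_piMr ?divr_ge0 ?(ltW d0)//.
  by rewrite ler_pdivrMr ?mul1r ?ler_nat.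
have := phiP s ss sk x; have := phiP s' ss' sk' x.
rewrite !size_map sk sk' subnn /= => h1 h2.
rewrite -(subrKA (Llim k (v x) [::])) (le_trans (ler_normD _ _))//.
rewrite [leRHS]splitr lerD//; first exact: le_trans h2 ke.
by rewrite distrC; exact: le_trans h1 ke.
Qed.

End UltrafilterCombinatorics.

(** * Finite power sums and their triangle inequality *)

Section PowerSum.
Variables (R : realType) (p : R).
Hypothesis p1 : 1 < p.

Let p0 : 0 < p. Proof. exact: lt_trans ltr01 p1. Qed.

Lemma ler_powR_nneg (q x y : R) : 0 <= q -> 0 <= x -> x <= y -> x `^ q <= y `^ q.
Proof. by move=> q0 x0 xy; rewrite ge0_ler_powR ?nnegrE//; exact: le_trans xy. Qed.

Lemma powRK (x : R) : 0 <= x -> (x `^ p) `^ p^-1 = x.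
Proof. by move=> x0; rewrite -powRrM mulfV ?gt_eqF// powRr1. Qed.

Lemma powRVK (x : R) : 0 <= x -> (x `^ p^-1) `^ p = x.
Proof. by move=> x0; rewrite -powRrM mulVf ?gt_eqF// powRr1. Qed.

(** The [l_p] norm of a nonnegative pair; the binary form follows the tree, where each level
    contributes one more increment. *)
Definition padd (a b : R) : R := (a `^ p + b `^ p) `^ p^-1.

Lemma padd_ge0 a b : 0 <= padd a b. Proof. exact: powR_ge0. Qed.

Lemma paddC a b : padd a b = padd b a. Proof. by rewrite /padd addrC. Qed.

Lemma le_padd a b c d : 0 <= a -> 0 <= c -> a <= b -> c <= d ->
  padd a c <= padd b d.
Proof.
move=> a0 c0 ab cd; apply: ler_powR_nneg; first by rewrite invr_ge0 ltW.
  by rewrite addr_ge0 ?powR_ge0.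
by rewrite lerD// ler_powR_nneg// ltW.
Qed.

Lemma padd_ge a b : 0 <= a -> a <= padd a b.
Proof.
move=> a0; rewrite -[leLHS]powRK//; apply: ler_powR_nneg; rewrite ?powR_ge0//.
  by rewrite invr_ge0 ltW.
by rewrite lerDl powR_ge0.
Qed.

Lemma convex_powR2 (t x y : R) : 0 <= t <= 1 -> 0 <= x -> 0 <= y ->
  (t * x + (1 - t) * y) `^ p <= t * x `^ p + (1 - t) * y `^ p.
Proof.
move=> /andP[t0 t1] x0 y0.
have := @convex_powR R p (ltW p1) (Itv01 t0 t1) x y.
rewrite !inE/= !in_itv/= !andbT => /(_ x0 y0).
by rewrite !convRE.
Qed.

(* The increments of the convex function [x `^ p] grow: with
   [S := padd a b >= a] this is [(a + c)^p - a^p <= (S + c)^p - S^p]. *)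
Lemma padd_addl a b c : 0 <= a -> 0 <= c -> padd (a + c) b <= padd a b + c.
Proof.
move=> a0 c0; set S := padd a b.
have aS : a <= S by exact: padd_ge.
have S0 : 0 <= S := padd_ge0 _ _.
have SE : S `^ p = a `^ p + b `^ p by rewrite powRVK// addr_ge0 ?powR_ge0.
have Sc0 : 0 <= S + c by rewrite addr_ge0.
rewrite -[leRHS]powRK//; apply: ler_powR_nneg; rewrite ?invr_ge0 ?(ltW p0)//.
  by rewrite addr_ge0 ?powR_ge0.
have [d0|d0] := eqVneq (S + c - a) 0.
  have c0' : c = 0 by lra.
  by rewrite c0' !addr0 SE.
have {}d0 : 0 < S + c - a by rewrite lt_neqAle eq_sym d0/=; lra.
(* This weight writes [a + c] as a convex combination of [S + c] and [a], and the complementary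
   weight writes [S]; the two convexity inequalities are then added. *)
pose t := c / (S + c - a).
have t01 : 0 <= t <= 1.
  by rewrite divr_ge0//= ?(ltW d0)// ler_pdivrMr// mul1r; lra.
have t01' : 0 <= 1 - t <= 1 by lra.
have h1 := convex_powR2 t01 Sc0 a0.
have h2 := convex_powR2 t01' Sc0 a0.
have E1 : t * (S + c) + (1 - t) * a = a + c by rewrite /t; field; exact: lt0r_neq0.
have E2 : (1 - t) * (S + c) + (1 - (1 - t)) * a = S.
  by rewrite /t; field; exact: lt0r_neq0.
rewrite E1 in h1; rewrite E2 in h2.
lra.
Qed.

Lemma padd_addr a b c : 0 <= b -> 0 <= c -> padd a (b + c) <= padd a b + c.
Proof. by move=> b0 c0; rewrite paddC (paddC a b) padd_addl. Qed.

Definition pnorm (k : nat) (al : nat -> R) : R := (\sum_(j < k) al j `^ p) `^ p^-1.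

Lemma pnorm_ge0 k al : 0 <= pnorm k al. Proof. exact: powR_ge0. Qed.

Lemma pnorm0 al : pnorm 0 al = 0.
Proof. by rewrite /pnorm big_ord0 powR0// invr_eq0 gt_eqF. Qed.

Lemma pnormS k al : pnorm k.+1 al = padd (pnorm k al) (al k).
Proof.
by rewrite /pnorm /padd powRVK ?big_ord_recr//= sumr_ge0// => i _; exact: powR_ge0.
Qed.

(** Takes a uniform error out of the power sum, entry by entry, through [padd_addl] and
    [padd_addr]. *)
Lemma pnorm_add k (al : nat -> R) (c : R) : 0 <= c ->
  (forall j, 0 <= al j) -> pnorm k (fun j => al j + c) <= pnorm k al + k%:R * c.
Proof.
move=> c0 al0; elim: k => [|k IH]; first by rewrite !pnorm0 mul0r addr0.
rewrite !pnormS.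
have kc : 0 <= k%:R * c by rewrite mulr_ge0.
apply: (@le_trans _ _ (padd (pnorm k al + k%:R * c) (al k + c))).
  by apply: le_padd; rewrite ?pnorm_ge0 ?addr_ge0.
apply: (le_trans (padd_addr _ (al0 k) c0)).
have -> : k.+1%:R * c = k%:R * c + c by rewrite -natr1 mulrDl mul1r.
have H := padd_addl (al k) (pnorm_ge0 k al) kc.
by apply: le_trans (lerD H (lexx c)) _; rewrite -addrA.
Qed.

End PowerSum.

(** * The sequence lattice of a 1-unconditional basis *)

Section UnconditionalBasis.
Variables (R : realType) (E : completeNormedModType R) (e : nat -> E).
Hypotheses (ue : one_unconditional_basis e) (ne : normalized e).

Definition psum (c : nat -> R) (n : nat) : E := \sum_(i < n) c i *: e i.

Lemma psumE c : series (fun i => c i *: e i) = psum c.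
Proof. by apply/funext => n; rewrite /psum seriesEord. Qed.

(** Vectors of [E] are handled through coefficient sequences; [lmE] and [nrE] have their intended
    meaning under [cvE] only. *)
Definition cvE (c : nat -> R) : Prop := cvgn (series (fun i => c i *: e i)).

Definition lmE (c : nat -> R) : E := limn (series (fun i => c i *: e i)).

Definition nrE (c : nat -> R) : R := `|lmE c|.

Lemma cvE_psum c : cvE c -> psum c n @[n --> \oo] --> lmE c.
Proof. by rewrite /cvE /lmE psumE. Qed.

Lemma psum_cvE c x : psum c n @[n --> \oo] --> x -> cvE c /\ lmE c = x.
Proof.
move=> cx; rewrite /cvE /lmE psumE; split; first exact: cvgP cx.
exact: cvg_lim cx.
Qed.

Lemma nrE_ge0 c : 0 <= nrE c. Proof. exact: normr_ge0. Qed.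

(* Changing one coefficient [a m] into [c m] is a convex combination of [a]
   and of [a] with the sign of [a m] flipped. *)
Lemma psum_solid (n : nat) (a c : nat -> R) :
  (forall i, (i < n)%N -> `|c i| <= `|a i|) -> `|psum c n| <= `|psum a n|.
Proof.
move=> ca.
pose h m i : R := if (i < m)%N then c i else a i.
suff H m : (m <= n)%N -> `|psum (h m) n| <= `|psum a n|.
  apply: le_trans (H n (leqnn n)).
  by rewrite /psum (eq_bigr (fun i : 'I_n => h n i *: e i))// => i _; rewrite /h ltn_ord.
elim: m => [_|m IH mn]; first by rewrite /h.
apply: le_trans (IH (ltnW mn)).
have [am0|am0] := eqVneq (a m) 0.
  rewrite /psum (eq_bigr (fun i : 'I_n => h m i *: e i))// => i _; rewrite /h ltnS leq_eqVlt.
  case: ltngtP => //= im; rewrite im am0.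
  by have := ca m mn; rewrite am0 normr0 normr_le0 => /eqP ->.
pose s i := i == m.
pose h' i : R := (-1) ^+ s i * h m i.
(* The solution of [t * a m - (1 - t) * a m = c m]; it lies in [[0, 1]] because [|c m| <= |a m|]. *)
pose t := (c m / a m + 1) / 2.
have cam : `|c m / a m| <= 1.
  by rewrite normrM normfV ler_pdivrMr ?normr_gt0// mul1r ca.
have t0 : 0 <= t by move: cam; rewrite ler_norml => /andP[]; rewrite /t; lra.
have t1 : 0 <= 1 - t by move: cam; rewrite ler_norml => /andP[]; rewrite /t; lra.
have -> : psum (h m.+1) n = t *: psum (h m) n + (1 - t) *: psum h' n.
  rewrite /psum !scaler_sumr -big_split/=; apply: eq_bigr => i _.
  rewrite !scalerA -scalerDl; congr (_ *: _).
  rewrite /h' /s /h ltnS leq_eqVlt.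
  case: ltngtP => /= im.
  - by rewrite mul1r; ring.
  - by rewrite mul1r; ring.
  - by rewrite im expr1 /t; field.
have fl : `|psum h' n| <= `|psum (h m) n| by exact: ue.2.
apply: (le_trans (ler_normD _ _)).
rewrite (normrZ t) (normrZ (1 - t)) (ger0_norm t0) (ger0_norm t1).
by have := ler_wpM2l t1 fl; lra.
Qed.

(** A block of the series is a partial sum of a sequence padded with zeros, so [psum_solid]
    transfers the Cauchy criterion. *)
Lemma cvE_solid (a c : nat -> R) : (forall i, `|c i| <= `|a i|) -> cvE a -> cvE c.
Proof.
move=> ca /cvg_cauchy /cauchy_seriesP Ha; apply: cauchy_cvg; apply/cauchy_seriesP.
move=> d /Ha; apply: filterS => -[m n] /=; apply: le_lt_trans.
have H b : \sum_(m <= k < n) b k *: e k = psum (fun i => if (m <= i)%N then b i else 0) n.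
  rewrite (@big_nat_widenl _ _ _ m 0 n)//= big_mkcond big_mkord; apply: eq_bigr => i _.
  by case: ifP; rewrite ?scale0r.
by rewrite !H; apply: psum_solid => i _; case: ifP; rewrite ?normr0.
Qed.

Lemma nrE_solid (a c : nat -> R) : (forall i, `|c i| <= `|a i|) -> cvE a ->
  nrE c <= nrE a.
Proof.
move=> ca aE; have cE := cvE_solid ca aE.
apply: ler_cvg_to (cvg_norm (cvE_psum cE)) (cvg_norm (cvE_psum aE)) _.
by apply: nearW => n; apply: psum_solid => i _.
Qed.

Lemma cvE_abs c : cvE c -> cvE (fun i => `|c i|).
Proof. by apply: cvE_solid => i; rewrite normr_id. Qed.

Lemma nrE_abs c : cvE c -> nrE (fun i => `|c i|) = nrE c.
Proof.
move=> cE; apply/eqP; rewrite eq_le !nrE_solid// => [i||i]; rewrite ?normr_id//.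
exact: cvE_abs.
Qed.

Lemma lmE_add a c : cvE a -> cvE c ->
  cvE (fun i => a i + c i) /\ lmE (fun i => a i + c i) = lmE a + lmE c.
Proof.
move=> aE cE; apply: psum_cvE.
have -> : psum (fun i => a i + c i) = psum a + psum c.
  apply/funext => n; rewrite /psum -[RHS]big_split/=; apply: eq_bigr => i _.
  by rewrite scalerDl.
exact: cvgD (cvE_psum aE) (cvE_psum cE).
Qed.

Lemma cvE_add a c : cvE a -> cvE c -> cvE (fun i => a i + c i).
Proof. by move=> aE cE; have [] := lmE_add aE cE. Qed.

Lemma nrE_add a c : cvE a -> cvE c -> nrE (fun i => a i + c i) <= nrE a + nrE c.
Proof.
by move=> aE cE; rewrite /nrE; have [_ ->] := lmE_add aE cE; exact: ler_normD.
Qed.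

Lemma lmE_scale (l : R) a : cvE a ->
  cvE (fun i => l * a i) /\ lmE (fun i => l * a i) = l *: lmE a.
Proof.
move=> aE; apply: psum_cvE.
have -> : psum (fun i => l * a i) = fun n => l *: psum a n.
  by apply/funext => n; rewrite /psum scaler_sumr; apply: eq_bigr => i _; rewrite scalerA.
exact: cvgZl_tmp (cvE_psum aE).
Qed.

Lemma cvE_opp a : cvE a -> cvE (fun i => - a i).
Proof. by apply: cvE_solid => i; rewrite normrN. Qed.

Lemma cvE_sub a c : cvE a -> cvE c -> cvE (fun i => a i - c i).
Proof. by move=> aE cE; exact: cvE_add aE (cvE_opp cE). Qed.

Lemma lmE_fin c n : (forall i, (n <= i)%N -> c i = 0) -> cvE c /\ lmE c = psum c n.
Proof.
move=> c0; apply: psum_cvE; apply: cvg_near_cst; exists n => // m /= nm.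
rewrite /psum -(subnKC nm) big_split_ord/= [X in _ + X]big1 ?addr0// => i _.
by rewrite c0 ?scale0r// leq_addr.
Qed.

Definition head_part (n : nat) (c : nat -> R) (i : nat) : R := if (i < n)%N then c i else 0.
Definition tail_part (n : nat) (c : nat -> R) (i : nat) : R := if (i < n)%N then 0 else c i.

Lemma head_tail_part n c : c = (fun i => head_part n c i + tail_part n c i).
Proof. by apply/funext => i; rewrite /head_part /tail_part; case: ifP; rewrite ?addr0 ?add0r. Qed.

Lemma head_part_fin n c i : (n <= i)%N -> head_part n c i = 0.
Proof. by rewrite /head_part ltnNge => ->. Qed.

Lemma cvE_head_part n c : cvE (head_part n c).
Proof. by have [] := lmE_fin (@head_part_fin n c). Qed.

Lemma lmE_head_part n c : lmE (head_part n c) = psum c n.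
Proof.
have [_ ->] := lmE_fin (@head_part_fin n c).
by apply: eq_bigr => i _; rewrite /head_part ltn_ord.
Qed.

Lemma cvE_tail_part n c : cvE c -> cvE (tail_part n c).
Proof. by apply: cvE_solid => i; rewrite /tail_part; case: ifP; rewrite ?normr0. Qed.

Lemma nrE_head_part n c : cvE c -> nrE (head_part n c) <= nrE c.
Proof. by apply: nrE_solid => i; rewrite /head_part; case: ifP; rewrite ?normr0. Qed.

Lemma nrE_tail_part n c : cvE c -> nrE (tail_part n c) <= nrE c.
Proof. by apply: nrE_solid => i; rewrite /tail_part; case: ifP; rewrite ?normr0. Qed.

Lemma nrE_head_tail_part n c : cvE c -> nrE c <= nrE (head_part n c) + nrE (tail_part n c).
Proof.
move=> cE; rewrite {1}(head_tail_part n c).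
by apply: nrE_add; [exact: cvE_head_part|exact: cvE_tail_part].
Qed.

Lemma nrE_tail_part_small c (d : R) : cvE c -> 0 < d -> exists n, nrE (tail_part n c) < d.
Proof.
move=> cE d0; have /cvgrPdist_lt /(_ d d0) := cvE_psum cE.
move=> [n _ /(_ n (leqnn n)) Hn]; exists n; apply: le_lt_trans Hn.
have [_] := lmE_add (@cvE_head_part n c) (@cvE_tail_part n _ cE).
by rewrite -head_tail_part /nrE -(lmE_head_part n c) => ->; rewrite addrAC subrr add0r.
Qed.

Lemma nrE_head_part_le n c : nrE (head_part n c) <= \sum_(i < n) `|c i|.
Proof.
rewrite /nrE (lmE_head_part n c); apply: le_trans (ler_norm_sum _ _ _) _.
by apply: ler_sum => i _; rewrite normrZ ne mulr1.
Qed.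

Lemma coord_le c i : cvE c -> `|c i| <= nrE c.
Proof.
move=> cE; pose s j : R := if j == i then c i else 0.
have -> : `|c i| = nrE s.
  rewrite /nrE; have [|_ ->] := @lmE_fin s i.+1.
    by move=> j; rewrite /s; case: ltngtP.
  rewrite /psum (bigD1 ord_max)//= big1 => [|j]; last first.
    by rewrite -val_eqE /= /s => /negPf ->; rewrite scale0r.
  by rewrite /s eqxx addr0 normrZ ne mulr1.
by apply: nrE_solid => // j; rewrite /s; case: eqP => [->|]; rewrite ?normr0.
Qed.

Section PConvex.
Variable p : R.
Hypotheses (p1 : 1 < p) (pe : p_convex1 p e).

Lemma nrE_pconvex (k : nat) (c : 'I_k -> nat -> R) : (forall n, cvE (c n)) ->
  cvE (fun j => (\sum_(n < k) `|c n j| `^ p) `^ p^-1) ->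
  nrE (fun j => (\sum_(n < k) `|c n j| `^ p) `^ p^-1) <=
    (\sum_(n < k) nrE (c n) `^ p) `^ p^-1.
Proof.
move=> cE yE.
have p0 : 0 < p by exact: lt_trans ltr01 p1.
rewrite -[leLHS](powRK p1) ?nrE_ge0//; apply: ler_powR_nneg; rewrite ?invr_ge0 ?(ltW p0)//.
  exact: powR_ge0.
exact: (pe (k := k) (x := fun n => lmE (c n)) cE yE).
Qed.

(** With disjoint supports, the coordinatewise [l_p] combination in [p]-convexity collapses to
    [|a i + c i|]. *)
Lemma nrE_disjoint (a c : nat -> R) : cvE a -> cvE c ->
  (forall i, a i = 0 \/ c i = 0) ->
  nrE (fun i => a i + c i) <= padd p (nrE a) (nrE c).
Proof.
move=> aE cE ac.
pose b (n : 'I_2) := if n == ord0 then a else c.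
have p0 : 0 < p by exact: lt_trans ltr01 p1.
have bE : (fun j => (\sum_(n < 2) `|b n j| `^ p) `^ p^-1) = fun j => `|a j + c j|.
  apply/funext => j; rewrite !big_ord_recl big_ord0 /b /= addr0.
  by case: (ac j) => ->; rewrite normr0 powR0 ?gt_eqF// ?addr0 ?add0r powRK.
have acE := cvE_add aE cE.
rewrite -(nrE_abs acE) -bE; apply: le_trans (nrE_pconvex _ _) _ => [n||].
- by rewrite /b; case: ifP.
- by rewrite bE; exact: cvE_abs.
- by rewrite !big_ord_recl big_ord0 /b /= addr0.
Qed.

End PConvex.

Section Coordinates.

Lemma coord_exists : exists co : E -> nat -> R,
  forall x, cvE (co x) /\ lmE (co x) = x.
Proof.
have /choice[co Hco] : forall x, exists a, expands e a x.
  by move=> x; have [a [ax _]] := ue.1 x; exists a.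
by exists co => x; apply: psum_cvE; rewrite -psumE; exact: Hco.
Qed.

Lemma coord_unique a c : cvE a -> cvE c -> lmE a = lmE c -> a = c.
Proof.
move=> aE cE ac; have [b [_ bu]] := ue.1 (lmE a).
have <- : b = a by apply: bu; rewrite /expands psumE; exact: cvE_psum.
by apply: bu; rewrite /expands psumE ac; exact: cvE_psum.
Qed.

End Coordinates.

End UnconditionalBasis.

(** * Bounded functionals *)

Section OperatorNorm.
Variables (R : realType) (E : normedModType R).

Lemma opnorm_ub (f : E -> R) x : bdd_lin f -> `|x| <= 1 -> `|f x| <= opnorm f.
Proof.
move=> [_ [C fC]] x1; apply: ub_le_sup; last by exists x.
exists `|C| => _ [y [y1 ->]]; apply: le_trans (fC y) _.
apply: le_trans (ler_wpM2r _ (ler_norm C)) _ => //.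
by rewrite ler_piMr.
Qed.

Lemma opnorm_ge0 (f : E -> R) : bdd_lin f -> 0 <= opnorm f.
Proof.
move=> bf; apply: le_trans (normr_ge0 (f 0)) _; apply: opnorm_ub => //.
by rewrite normr0.
Qed.

Lemma opnorm_le (f : E -> R) x : bdd_lin f -> `|f x| <= opnorm f * `|x|.
Proof.
move=> bf; have [fl _] := bf.
have f0 : f 0 = 0 by have := fl 1 0 0; rewrite scaler0 addr0; lra.
have [->|x0] := eqVneq x 0; first by rewrite f0 !normr0 mulr0.
have nx : 0 < `|x| by rewrite normr_gt0.
rewrite -ler_pdivrMr//.
have -> : `|f x| / `|x| = `|f (`|x|^-1 *: x)|.
  have := fl `|x|^-1 x 0; rewrite f0 !addr0 => ->.
  by rewrite normrM normfV normr_id mulrC.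
apply: opnorm_ub => //.
by rewrite normrZ normfV normr_id mulVf ?gt_eqF.
Qed.

End OperatorNorm.

(** * Coordinatewise ultrafilter limits of bounded vectors *)

Section Fatou.
Variables (R : realType) (E : completeNormedModType R) (e : nat -> E).
Hypotheses (ue : one_unconditional_basis e) (ne : normalized e).
Hypothesis re : reflexive_space E.
Variables (U : set_system nat).
Hypotheses (UU : UltraFilter U).

Local Instance ultra_proper_Fatou : ProperFilter U := @ultra_proper _ _ UU.

(* Reflexivity, applied to the functional [f |-> lim_U f (c t)], replaces weak
   compactness and makes the basis boundedly complete. *)
Lemma ultralimit_cvE (c : nat -> nat -> R) (l : nat -> R) (C : R) :
  (\forall t \near U, cvE e (c t) /\ nrE e (c t) <= C) ->
  (forall i, c t i @[t --> U] --> l i) -> cvE e l /\ nrE e l <= C.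
Proof.
move=> cC cl.
have [t0 [_ t0C]] := filter_ex cC.
have C0 : 0 <= C by exact: le_trans (nrE_ge0 _ _) t0C.
have [co coP] := coord_exists ue.
pose y t := lmE e (c t).
have co_add a x z i : co (a *: x + z) i = a * co x i + co z i.
  have [h1 h2] := lmE_scale a (coP x).1.
  have [h3 h4] := lmE_add h1 (coP z).1.
  rewrite (@coord_unique _ _ _ ue (co (a *: x + z)) (fun i => a * co x i + co z i))//.
    exact: (coP _).1.
  by rewrite h4 h2 !(coP _).2.
have co_lin i : bdd_lin (fun x => co x i).
  split=> [a x z|]; first exact: co_add.
  exists 1 => x; rewrite mul1r.
  by have := coord_le ue ne i (coP x).1; rewrite /nrE (coP x).2.
have cvf f : bdd_lin f -> f (y t) @[t --> U] --> limU U (fun t => f (y t)).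
  move=> bf; apply: (@cvg_limU _ _ UU _ (opnorm f * C)).
  apply: filterS cC => t [_ tC]; apply: le_trans (opnorm_le _ bf) _.
  by apply: ler_wpM2l => //; exact: opnorm_ge0.
pose Phi (f : E -> R) : R := limU U (fun t => f (y t)).
have [x xP] : exists x : E, forall f, bdd_lin f -> Phi f = f x.
  apply: re => [a f g bf bg|].
    apply: cvg_lim => //; apply: cvgD; last exact: cvf.
    by apply: cvgMl_tmp; exact: cvf.
  exists C => f bf; apply: limU_le => //; apply: filterS cC => t [_ tC].
  apply: le_trans (opnorm_le _ bf) _.
  by rewrite mulrC; apply: ler_wpM2r => //; exact: opnorm_ge0.
(* The coordinate functionals are bounded, so the vector given by reflexivity has the limits [l i]
   as coordinates. *)
have lx : l = co x.
  apply/funext => i; rewrite -(xP _ (co_lin i)).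
  have := cvf _ (co_lin i); apply: cvg_unique => //=.
  apply: cvg_trans (cl i); apply: near_eq_cvg; apply: filterS cC => t [tE _].
  congr (_ i); apply: (coord_unique ue) => //; first exact: (coP _).1.
  by rewrite (coP _).2.
have lE : cvE e l by rewrite lx; exact: (coP _).1.
(* The bound passes to each partial sum, a finite combination converging in norm along [U], and from
   there to [lmE e l]. *)
split=> //; apply: cvg_norm_le (cvE_psum lE) _; apply: nearW => n.
have Hn : psum e (c t) n @[t --> U] --> psum e l n.
  rewrite /psum; elim: n => [|n IH].
    by rewrite big_ord0; apply: cvg_near_cst; apply: nearW => t; rewrite big_ord0.
  rewrite big_ord_recr/=.
  have -> : (fun t => \sum_(i < n.+1) c t i *: e i) =
    (fun t => \sum_(i < n) c t i *: e i) + (fun t => c t n *: e n).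
    by apply/funext => t; rewrite big_ord_recr.
  by apply: cvgD => //; apply: cvgZr_tmp; exact: cl.
apply: cvg_norm_le Hn _; apply: filterS cC => t [tE tC].
by apply: le_trans tC; rewrite -lmE_head_part; exact: nrE_head_part.
Qed.

End Fatou.

(** * Concentration of the tail *)

Section TailConcentration.
Variables (R : realType) (p : R) (E : completeNormedModType R) (e : nat -> E).
Hypotheses (p1 : 1 < p) (ue : one_unconditional_basis e) (ne : normalized e).
Hypotheses (pe : p_convex1 p e) (re : reflexive_space E).
Variables (U : set_system nat).
Hypotheses (UU : UltraFilter U) (Uoo : \oo `<=` U).

Local Instance ultra_proper_tail : ProperFilter U := @ultra_proper _ _ UU.

Lemma ultra_all_lt (s : seq nat) : \forall t \near U, all (fun x => (x < t)%N) s.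
Proof.
elim: s => [|x s IH]; first by apply: nearW.
by apply: filterS2 (ultra_gt Uoo x) IH => t /= -> ->.
Qed.

Variables (k : nat) (G : seq nat -> nat -> R) (C : R) (al : nat -> R).
Hypothesis GC : forall s, cvE e (G s) /\ nrE e (G s) <= C.
Hypothesis Gal : forall j s s', (j < k)%N -> sorted ltn s -> sorted ltn s' ->
  size s = k -> size s' = k -> (forall i, i != j -> nth 0%N s i = nth 0%N s' i) ->
  (nth 0 s j < nth 0 s' j)%N -> nrE e (fun i => G s i - G s' i) <= al j.

Definition tree_lim (m : nat) (s : seq nat) (i : nat) : R := Llim U m (G^~ i) s.

Lemma G_coord_le s i : `|G s i| <= C.
Proof. by have [sE sC] := GC s; apply: le_trans sC; exact: coord_le. Qed.

Lemma cvg_tree_lim m s i : tree_lim m (rcons s t) i @[t --> U] --> tree_lim m.+1 s i.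
Proof. by apply: (@cvg_Llim _ _ UU C) => s'; exact: G_coord_le. Qed.

Lemma cvE_tree_lim m s : cvE e (tree_lim m s) /\ nrE e (tree_lim m s) <= C.
Proof.
elim: m s => [|m IH] s; first exact: GC.
apply: (@ultralimit_cvE _ _ _ ue ne re _ UU (fun t => tree_lim m (rcons s t))).
  by apply: nearW => t; exact: IH.
by move=> i; exact: cvg_tree_lim.
Qed.

(** Both lists are extended by the same large entries up to length [k], where [Gal] applies; the
    bound survives each limit by [ultralimit_cvE]. *)
Lemma nrE_tree_lim_diff m j s s' : (size s + m = k)%N -> size s' = size s ->
  sorted ltn s -> sorted ltn s' -> (j < size s)%N ->
  (forall i, i != j -> nth 0%N s i = nth 0%N s' i) ->
  (nth 0 s j < nth 0 s' j)%N -> nrE e (fun i => tree_lim m s i - tree_lim m s' i) <= al j.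
Proof.
elim: m s s' => [|m IH] s s' sk ss' so so' js nj lj.
  by apply: (@Gal j s s') => //; lia.
apply: (proj2 (@ultralimit_cvE _ _ _ ue ne re _ UU
  (fun t i => tree_lim m (rcons s t) i - tree_lim m (rcons s' t) i) _ _ _ _)); last first.
  by move=> i; apply: cvgB; exact: cvg_tree_lim.
apply: filterS2 (ultra_all_lt s) (ultra_all_lt s') => t st st'; split.
  by apply: cvE_sub => //; exact: (cvE_tree_lim _ _).1.
apply: IH.
- by rewrite size_rcons; lia.
- by rewrite !size_rcons ss'.
- by rewrite sorted_rcons_ltn so.
- by rewrite sorted_rcons_ltn so'.
- by rewrite size_rcons; lia.
- by move=> i ij; rewrite !nth_rcons ss'; case: ifP => // _; exact: nj.
- by rewrite !nth_rcons ss' js.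
Qed.

(** The value at the node [s] is the limit over [t' > t] of the values at [rcons s t'], and
    [rcons s t] differs from these lists in its last entry only. *)
Lemma nrE_tree_lim_step m s t : (size s + m.+1 = k)%N -> sorted ltn (rcons s t) ->
  nrE e (fun i => tree_lim m (rcons s t) i - tree_lim m.+1 s i) <= al (size s).
Proof.
move=> sk st.
apply: (proj2 (@ultralimit_cvE _ _ _ ue ne re _ UU
  (fun t' i => tree_lim m (rcons s t) i - tree_lim m (rcons s t') i) _ _ _ _)); last first.
  by move=> i; apply: cvgB; [exact: cvg_cst|exact: cvg_tree_lim].
apply: filterS2 (ultra_all_lt s) (ultra_gt Uoo t) => t' st' tt'; split.
  by apply: cvE_sub => //; exact: (cvE_tree_lim _ _).1.
apply: nrE_tree_lim_diff.
- by rewrite size_rcons; lia.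
- by rewrite !size_rcons.
- by [].
- by move: st; rewrite !sorted_rcons_ltn => /andP[-> _].
- by rewrite size_rcons.
- move=> i ij; rewrite !nth_rcons (negPf ij).
  by case: ifP.
- by rewrite !nth_rcons ltnn eqxx.
Qed.

Lemma near_nrE_head_part (D : nat -> nat -> R) n (d : R) : 0 < d ->
  (forall i, D t i @[t --> U] --> 0) -> \forall t \near U, nrE e (head_part n (D t)) <= d.
Proof.
move=> d0 D0.
have dn0 : 0 < d / n.+1%:R by rewrite divr_gt0.
have H : \forall t \near U, forall i : 'I_n, `|D t i| <= d / n.+1%:R.
  apply: filter_forall => i; have /cvgrPdist_le /(_ _ dn0) := D0 i.
  by apply: filterS => t; rewrite sub0r normrN.
apply: filterS H => t Ht; apply: le_trans (nrE_head_part_le ne _ _) _.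
apply: le_trans (ler_sum _ (fun i _ => Ht i)) _.
rewrite sumr_const card_ord -[leLHS]mulr_natr -mulrA ler_piMr ?(ltW d0)// mulrC.
by rewrite ler_pdivrMr// mul1r ler_nat.
Qed.

(* Gliding hump: beyond [n0], the vector at [s] is concentrated before some
   [n1], while the increment at [rcons s t] lives after [n1] for most [t]. *)
Lemma near_tail_step n0 m s (c d : R) : 0 <= c -> 0 < d -> (size s + m.+1 = k)%N ->
  sorted ltn s -> nrE e (tail_part n0 (tree_lim m.+1 s)) <= c ->
  \forall t \near U, sorted ltn (rcons s t) /\
    nrE e (tail_part n0 (tree_lim m (rcons s t))) <= padd p c (al (size s)) + 2 * d.
Proof.
move=> c0 d0 sk so sc.
set x := tree_lim m.+1 s in sc *.
have xE : cvE e x by exact: (cvE_tree_lim _ _).1.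
have yE : cvE e (tail_part n0 x) by exact: cvE_tail_part.
have [n1 yn1] := nrE_tail_part_small ue yE d0.
pose D t i := tree_lim m (rcons s t) i - x i.
have DE t : cvE e (D t) by apply: cvE_sub => //; exact: (cvE_tree_lim _ _).1.
have Dn1 : \forall t \near U, nrE e (head_part n1 (D t)) <= d.
  apply: near_nrE_head_part => // i; rewrite -(subrr (x i)).
  by apply: cvgB; [exact: cvg_tree_lim|exact: cvg_cst].
apply: filterS2 Dn1 (ultra_all_lt s) => t Dt st.
have ss : sorted ltn (rcons s t) by rewrite sorted_rcons_ltn so.
split=> //.
have Dal : nrE e (D t) <= al (size s) by exact: nrE_tree_lim_step.
pose z := tail_part n0 (D t).
have zE : cvE e z by exact: cvE_tail_part.
(* The first bracket has disjoint supports, so [padd] bounds it; the second collects two remainders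
   of norm at most [d] each. *)
have -> : tail_part n0 (tree_lim m (rcons s t)) =
    fun i => (head_part n1 (tail_part n0 x) i + tail_part n1 z i) +
      (tail_part n1 (tail_part n0 x) i + head_part n1 z i).
  apply/funext => i; rewrite /z /head_part /tail_part /D.
  by case: (i < n0)%N; case: (i < n1)%N; ring.
have h1 := @cvE_head_part _ _ e n1 (tail_part n0 x).
have h2 := cvE_tail_part (n := n1) ue zE.
have h3 := cvE_tail_part (n := n1) ue yE.
have h4 := @cvE_head_part _ _ e n1 z.
apply: le_trans (nrE_add (cvE_add h1 h2) (cvE_add h3 h4)) _; apply: lerD.
  apply: le_trans (nrE_disjoint ue p1 pe h1 h2 _) _.
    by move=> i; rewrite /head_part /tail_part; case: (i < n1)%N; [right|left].
  apply: le_padd; rewrite ?nrE_ge0//.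
    by apply: le_trans sc; exact: nrE_head_part.
  apply: le_trans (nrE_tail_part ue n1 zE) _.
  by apply: le_trans Dal; exact: nrE_tail_part.
apply: le_trans (nrE_add h3 h4) _; rewrite mulr_natl mulr2n; apply: lerD.
  exact: ltW.
apply: le_trans Dt; apply: (nrE_solid ue); last exact: cvE_head_part.
by move=> i; rewrite /z /head_part /tail_part; case: (i < n1)%N; case: (i < n0)%N; rewrite ?normr0.
Qed.

Lemma tail_concentration (d : R) : 0 < d -> exists n0 (phi : nat -> nat),
  {homo phi : i j / (i < j)%N} /\
  forall s, sorted ltn s -> size s = k ->
    nrE e (tail_part n0 (G (map phi s))) <= pnorm p k al + d.
Proof.
(* The root costs [d1] and each of the [k] levels costs [2 * d1], which adds up to [d]. *)
move=> d0; pose d1 := d / (2 * k%:R + 1).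
have k0 : 0 < 2 * k%:R + 1 :> R by rewrite ltr_wpDl// mulr_ge0.
have d10 : 0 < d1 by rewrite divr_gt0.
(* The cut [n0] depends only on the root, the full iterated limit, and so serves all tuples. *)
have [n0 Hn0] := nrE_tail_part_small ue (cvE_tree_lim k [::]).1 d10.
pose Inv s := sorted ltn s /\ nrE e (tail_part n0 (tree_lim (k - size s) s)) <=
  pnorm p (size s) al + (2 * (size s)%:R + 1) * d1.
have UI : Uall U k Inv [::].
  apply: (Uall_inv UU).
    split=> //=; rewrite subn0 pnorm0// mulr0 !add0r mul1r; exact: ltW.
  move=> s sk [so sI].
  pose m := (k - (size s).+1)%N.
  have skm : (size s + m.+1 = k)%N by rewrite /m; lia.
  have Em : (k - size s = m.+1)%N by lia.
  have c0 : 0 <= (2 * (size s)%:R + 1) * d1.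
    by rewrite mulr_ge0 ?(ltW d10)// addr_ge0 ?mulr_ge0.
  rewrite Em in sI.
  have := near_tail_step (addr_ge0 (pnorm_ge0 _ _ _) c0) d10 skm so sI.
  apply: filterS => t [st tI]; split=> //; rewrite size_rcons -/m.
  apply: le_trans tI _.
  have -> : (2 * (size s).+1%:R + 1) * d1 = (2 * (size s)%:R + 1) * d1 + 2 * d1.
    by rewrite -natr1; ring.
  rewrite [leRHS]addrA; apply: lerD => //.
  (* The error accumulated so far leaves the power sum without being enlarged. *)
  rewrite pnormS//; apply: padd_addl => //; exact: pnorm_ge0.
have [phi [phi_lt phiP]] := Uall_subsequence UU Uoo UI.
exists n0, phi; split=> // s so sk.
have [_] := phiP s so sk.
rewrite size_map sk subnn /d1 mulrCA mulfV ?gt_eqF// mulr1.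
exact.
Qed.

End TailConcentration.

(** * Increasing tuples *)

Section Tuples.

Lemma infinite_enum (M : set nat) : infinite_set M ->
  exists psi : nat -> nat, {homo psi : i j / (i < j)%N} /\ forall i, M (psi i).
Proof.
move=> Minf.
have /choice[nxt Hn] : forall a, exists t, (a < t)%N /\ M t.
  move=> a; apply: contrapT => H; apply: Minf.
  apply: (@sub_finite_set _ _ `I_a.+1); last exact: finite_II.
  move=> t Mt /=; rewrite ltnS leqNgt; apply/negP => at_; apply: H.
  by exists t.
exists (fun i => iter i.+1 nxt 0%N); split=> [|i]; last by case: (Hn (iter i nxt 0%N)).
apply: homo_ltn => [? ? ?|i]; first exact: ltn_trans.
by case: (Hn (iter i.+1 nxt 0%N)).
Qed.

Lemma homo_ltn_reflect (phi : nat -> nat) : {homo phi : i j / (i < j)%N} ->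
  forall i j, (phi i < phi j)%N -> (i < j)%N.
Proof.
move=> phi_lt i j; apply: contraTT; rewrite -!leqNgt leq_eqVlt.
by move=> /predU1P[->//|/phi_lt/ltnW].
Qed.

Lemma infinite_range_homo (phi : nat -> nat) : {homo phi : i j / (i < j)%N} ->
  infinite_set (range phi).
Proof.
move=> phi_lt; have inj : {in phi @^-1` range phi &, injective phi}.
  move=> i j _ _ E; have := homo_ltn_reflect phi_lt.
  by case: (ltngtP i j) => // /phi_lt; rewrite E ltnn.
move=> /(finite_preimage inj); apply/contra_not: infinite_nat => H.
by apply: sub_finite_set H => i _; exists i.
Qed.

Variable k : nat.
Implicit Types n m : 'I_k -> nat.

Definition tuple_of_seq (s : seq nat) : 'I_k -> nat := fun i => nth 0%N s i.
Definition seq_of_tuple n : seq nat := [seq n i | i <- enum 'I_k].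

Lemma size_seq_of_tuple n : size (seq_of_tuple n) = k.
Proof. by rewrite size_map size_enum_ord. Qed.

Lemma nth_seq_of_tuple n (i : 'I_k) : nth 0%N (seq_of_tuple n) i = n i.
Proof. by rewrite (nth_map i) ?size_enum_ord// nth_ord_enum. Qed.

Lemma seq_of_tupleK n : tuple_of_seq (seq_of_tuple n) = n.
Proof. by apply/funext => i; exact: nth_seq_of_tuple. Qed.

Lemma sorted_seq_of_tuple n : incr n -> sorted ltn (seq_of_tuple n).
Proof.
move=> ni; apply/(sortedP 0%N) => i; rewrite size_seq_of_tuple => ik.
by rewrite (nth_seq_of_tuple n (Ordinal (ltnW ik))) (nth_seq_of_tuple n (Ordinal ik)); exact: ni.
Qed.

Lemma incr_tuple_of_seq s : sorted ltn s -> size s = k -> incr (tuple_of_seq s).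
Proof.
move=> ss sk i j ij.
by apply: (sorted_ltn_nth ltn_trans) => //; rewrite inE sk.
Qed.

Lemma incr_comp (phi : nat -> nat) n : {homo phi : i j / (i < j)%N} -> incr n ->
  incr (phi \o n).
Proof. by move=> phi_lt ni i j ij; apply: phi_lt; exact: ni. Qed.

Lemma seq_of_tuple_comp (phi : nat -> nat) n : seq_of_tuple (phi \o n) = map phi (seq_of_tuple n).
Proof. by rewrite /seq_of_tuple -map_comp. Qed.

Lemma H_pair_comp (phi : nat -> nat) j n m : {homo phi : i j / (i < j)%N} ->
  H_pair setT j n m -> H_pair setT j (phi \o n) (phi \o m).
Proof.
move=> phi_lt [[ni _] [[mi _] [nm nmj]]]; split; first by split=> //; exact: incr_comp.
split; first by split=> //; exact: incr_comp.
by split=> [i ij /=|]; [rewrite nm|exact: phi_lt].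
Qed.

Lemma interlaced_comp (phi : nat -> nat) n m : {homo phi : i j / (i < j)%N} ->
  interlaced setT n m -> interlaced setT (phi \o n) (phi \o m).
Proof.
move=> phi_lt [[ni _] [[mi _] [nm mn]]]; split; first by split=> //; exact: incr_comp.
split; first by split=> //; exact: incr_comp.
by split=> [i|i j ij]; apply: phi_lt; [exact: nm|exact: mn].
Qed.

Lemma interlaced_range (phi : nat -> nat) n m : {homo phi : i j / (i < j)%N} ->
  interlaced (range phi) n m -> exists n' m',
    [/\ interlaced setT n' m', n = phi \o n' & m = phi \o m'].
Proof.
move=> phi_lt [[ni nM] [[mi mM] [nm mn]]].
have /choice[n' n'E] : forall i, exists x, n i = phi x.
  by move=> i; have [x _ <-] := nM i; exists x.
have /choice[m' m'E] : forall i, exists x, m i = phi x.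
  by move=> i; have [x _ <-] := mM i; exists x.
have r := homo_ltn_reflect phi_lt.
exists n', m'; split; last 2 first.
- by apply/funext => i /=.
- by apply/funext => i /=.
split; first by split=> // i j ij; apply: r; rewrite -!n'E; exact: ni.
split; first by split=> // i j ij; apply: r; rewrite -!m'E; exact: mi.
by split=> [i|i j ij]; apply: r; rewrite -n'E -m'E; [exact: nm|exact: mn].
Qed.

(* Deleting entry [h] of an increasing (k+1)-list; deleting entries [j.+1] and
   [j] of the same list parametrizes the pairs of [H_pair setT j]. *)
Definition del_nth (h : nat) (s : seq nat) : 'I_k -> nat := fun i => nth 0%N s (bump h i).

Lemma H_pair_del_nth (j : 'I_k) s : sorted ltn s -> size s = k.+1 ->
  H_pair setT j (del_nth j.+1 s) (del_nth j s).
Proof.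
move=> ss sk.
have lt a b : (a < b)%N -> (b < k.+1)%N -> (nth 0 s a < nth 0 s b)%N.
  move=> ab bk; apply: (sorted_ltn_nth ltn_trans) => //; rewrite inE sk//.
  exact: ltn_trans bk.
have di h : incr (del_nth h s).
  by move=> a b ab; apply: lt; have := ltn_ord b; rewrite /bump; lia.
split; first by split.
split; first by split.
split=> [i ij|]; rewrite /del_nth.
  congr nth; rewrite /bump; have : val i <> val j by move/val_inj/eqP; rewrite (negPf ij).
  by move=> /=; lia.
by apply: lt; have := ltn_ord j; rewrite /bump; lia.
Qed.

Lemma H_pair_del_nthP (j : 'I_k) n m : H_pair setT j n m ->
  exists s, [/\ sorted ltn s, size s = k.+1, del_nth j.+1 s = n & del_nth j s = m].
Proof.
move=> [[ni _] [[mi _] [nm nmj]]].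
(* The merged list is [n 0, ..., n j, m j, ..., m (k - 1)], increasing at the junction since
   [n j < m j]. *)
pose F q := if (q <= j)%N then nth 0%N (seq_of_tuple n) q else nth 0%N (seq_of_tuple m) q.-1.
exists (mkseq F k.+1); rewrite size_mkseq; split=> //.
- apply/(sortedP 0%N) => q; rewrite size_mkseq => qk.
  rewrite !nth_mkseq ?(ltnW qk)// /F.
  have [q1j|jq1] := leqP q.+1 j.
    rewrite (ltnW q1j).
    have q1k : (q.+1 < k)%N by exact: leq_ltn_trans q1j (ltn_ord j).
    rewrite (nth_seq_of_tuple n (Ordinal (ltnW q1k))) (nth_seq_of_tuple n (Ordinal q1k)).
    exact: ni.
  have qk' : (q < k)%N by [].
  rewrite /= (nth_seq_of_tuple m (Ordinal qk')).
  have [qj|jq] := leqP q j.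
    have Eq : q = j by lia.
    have -> : Ordinal qk' = j by apply: val_inj.
    by rewrite Eq nth_seq_of_tuple.
  have q1k : (q.-1 < k)%N by lia.
  by rewrite (nth_seq_of_tuple m (Ordinal q1k)); apply: mi => /=; lia.
- apply/funext => i; rewrite /del_nth nth_mkseq; last by have := ltn_ord i; rewrite /bump; lia.
  rewrite /F /bump; have [ji|ij] := ltnP j i.
    rewrite add1n ltnNge ltnW//= nth_seq_of_tuple nm//.
    by rewrite -val_eqE /= gtn_eqF.
  by rewrite add0n ij nth_seq_of_tuple.
- apply/funext => i; rewrite /del_nth nth_mkseq; last by have := ltn_ord i; rewrite /bump; lia.
  rewrite /F /bump; have [ji|ij] := leqP j i.
    by rewrite add1n ltnNge ji/= nth_seq_of_tuple.
  rewrite add0n ltnW// nth_seq_of_tuple nm//.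
  by rewrite -val_eqE /= ltn_eqF.
Qed.

Lemma H_pair_exists (j : 'I_k) : exists n m, H_pair setT j n m.
Proof.
exists (del_nth j.+1 (iota 0 k.+1)), (del_nth j (iota 0 k.+1)); apply: H_pair_del_nth.
  exact: iota_ltn_sorted.
by rewrite size_iota.
Qed.

End Tuples.

(** * The moduli of a map on the Hamming graph *)

Section Alpha.
Variables (R : realType) (T : Type) (d : T -> T -> R) (k : nat).
Variables (f : ('I_k -> nat) -> T).

(** The uniform bound rules out the default value that [sup] takes on unbounded sets. *)
Lemma alpha_ge (C : R) j n m : (forall n m, incr n -> incr m -> d (f n) (f m) <= C) ->
  H_pair setT j n m -> d (f n) (f m) <= alpha d f j.
Proof.
move=> dC nm; apply: ub_le_sup; last by exists n, m.
by exists C => _ [n' [m' [[[ni _] [[mi _] _]] ->]]]; exact: dC.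
Qed.

Lemma alpha_le (C : R) j : (forall n m, H_pair setT j n m -> d (f n) (f m) <= C) ->
  alpha d f j <= C.
Proof.
move=> dC; apply: ge_sup; last by move=> _ [n [m [/dC nm ->]]].
by have [n [m nm]] := H_pair_exists j; exists (d (f n) (f m)), n, m.
Qed.

Lemma alpha_ge0 (C : R) j : (forall x y, 0 <= d x y) ->
  (forall n m, incr n -> incr m -> d (f n) (f m) <= C) -> 0 <= alpha d f j.
Proof.
move=> d0 dC; have [n [m nm]] := H_pair_exists j.
by apply: le_trans (alpha_ge dC nm).
Qed.

(** [pnorm] and the levels of the tree are indexed by [nat], hence the extension by zero. *)
Definition alpha_nat (j : nat) : R := if insub j is Some i then alpha d f i else 0.

Lemma alpha_natE (j : 'I_k) : alpha_nat j = alpha d f j.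
Proof. by rewrite /alpha_nat valK. Qed.

End Alpha.

Lemma dH_comp k (phi : nat -> nat) (n m : 'I_k -> nat) :
  {homo phi : i j / (i < j)%N} -> dH (phi \o n) (phi \o m) = dH n m.
Proof.
move=> phi_lt; apply: eq_card => i; rewrite !inE /=; congr (~~ _).
apply/eqP/eqP => [E|->//]; have := homo_ltn_reflect phi_lt.
by case: (ltngtP (n i) (m i)) => // /phi_lt; rewrite E ltnn.
Qed.

Lemma dH_le k (n m : 'I_k -> nat) : (dH n m <= k)%N.
Proof. by rewrite -[leqRHS]card_ord; exact: max_card. Qed.

(** * The hypothesis on finitely many summands *)

Section Heads.
Variables (R : realType) (p lambda : R) (k : nat).
Hypotheses (p1 : 1 < p) (lambda0 : 0 < lambda).

(** Precomposition with [phi] preserves the Hamming distance, hence the Lipschitz bound, while its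
    moduli see only tuples from the range of [phi]. Bounds [b] available only after a Ramsey
    selection can thus replace the moduli of [g]. *)
Lemma HIC_subsequence (V : normedModType R) (g : ('I_k -> nat) -> V) (L : R)
  (phi : nat -> nat) (b : 'I_k -> R) :
  HIC p lambda (@normdist R V) ->
  (forall n m, incr n -> incr m -> `|g n - g m| <= L * (dH n m)%:R) ->
  {homo phi : i j / (i < j)%N} ->
  (forall j n m, H_pair setT j n m -> `|g (phi \o n) - g (phi \o m)| <= b j) ->
  exists psi : nat -> nat, {homo psi : i j / (i < j)%N} /\
    forall n m, interlaced setT n m ->
      `|g (phi \o (psi \o n)) - g (phi \o (psi \o m))| <=
        lambda * (\sum_(j < k) b j `^ p) `^ p^-1.
Proof.
move=> hV gL phi_lt gb.
pose g' n := g (phi \o n).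
have g'L n m : incr n -> incr m -> normdist (g' n) (g' m) <= L * (dH n m)%:R.
  by move=> ni mi; rewrite -(dH_comp n m phi_lt); apply: gL; exact: incr_comp.
have g'C n m : incr n -> incr m -> normdist (g' n) (g' m) <= `|L| * k%:R.
  move=> ni mi; apply: le_trans (g'L _ _ ni mi) _.
  apply: le_trans (ler_wpM2r _ (ler_norm L)) _ => //.
  by apply: ler_wpM2l => //; rewrite ler_nat dH_le.
have [M [Minf MP]] : exists M : set nat, infinite_set M /\
    forall n m, interlaced M n m -> normdist (g' n) (g' m) <=
      lambda * (\sum_(j < k) (alpha (@normdist R V) g' j) `^ p) `^ p^-1.
  by apply: hV; exists L => n m [ni _] [mi _]; exact: g'L.
have [psi [psi_lt psiM]] := infinite_enum Minf.
exists psi; split=> // n m nm.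
apply: le_trans (MP (psi \o n) (psi \o m) _) _.
  have [[ni _] [[mi _] H]] := interlaced_comp psi_lt nm.
  split; first by split=> // i; exact: psiM.
  by split=> //; split=> // i; exact: psiM.
apply: ler_wpM2l; first exact: ltW.
have p0 : 0 <= p by exact: le_trans ler01 (ltW p1).
apply: ler_powR_nneg; rewrite ?invr_ge0//.
  by rewrite sumr_ge0// => j _; exact: powR_ge0.
apply: ler_sum => j _; apply: ler_powR_nneg => //.
  by apply: alpha_ge0 g'C => x y; exact: normr_ge0.
by apply: alpha_le => n' m'; exact: gb.
Qed.

(** One extraction per summand; earlier estimates persist because increasing maps preserve
    interlaced pairs. *)
Lemma HIC_subsequence_finite (X : nat -> normedModType R)
  (g : forall i, ('I_k -> nat) -> X i) (L : R)
  (phi : nat -> nat) (b : nat -> 'I_k -> R) (N : nat) :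
  (forall i, HIC p lambda (@normdist R (X i))) ->
  (forall i n m, incr n -> incr m -> `|g i n - g i m| <= L * (dH n m)%:R) ->
  {homo phi : i j / (i < j)%N} ->
  (forall i j n m, (i < N)%N -> H_pair setT j n m ->
     `|g i (phi \o n) - g i (phi \o m)| <= b i j) ->
  exists psi : nat -> nat, {homo psi : i j / (i < j)%N} /\
    forall i n m, (i < N)%N -> interlaced setT n m ->
      `|g i (phi \o (psi \o n)) - g i (phi \o (psi \o m))| <=
        lambda * (\sum_(j < k) b i j `^ p) `^ p^-1.
Proof.
move=> hX gL phi_lt; elim: N => [|N IH] gb.
  by exists id; split=> // i n m.
have [|psi [psi_lt psiP]] := IH.
  by move=> i j n m iN; apply: gb; exact: ltnW.
have pp_lt : {homo phi \o psi : i j / (i < j)%N} by move=> i j /psi_lt /phi_lt.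
have [|chi [chi_lt chiP]] := HIC_subsequence (b := b N) (hX N) (gL N) pp_lt.
  by move=> j n m nm; apply: gb => //; exact: H_pair_comp.
exists (psi \o chi); split=> [i j /chi_lt/psi_lt//|i n m].
rewrite ltnS leq_eqVlt => /predU1P[->|iN] nm; first exact: chiP.
by apply: (psiP i (chi \o n) (chi \o m)) => //; exact: interlaced_comp.
Qed.

End Heads.

(** * Concentration in the sum *)

Section SumConcentration.
Variables (R : realType) (p lambda : R).
Variables (X : nat -> completeNormedModType R) (E : completeNormedModType R).
Variable e : nat -> E.
Hypotheses (p1 : 1 < p) (lambda0 : 0 < lambda).
Hypothesis hX : forall n, HIC p lambda (@normdist R (X n)).
Hypotheses (re : reflexive_space E) (ne : normalized e).
Hypotheses (ue : one_unconditional_basis e) (pe : p_convex1 p e).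

Local Notation d := (@sumE_dist R (fun n => X n : normedModType R) E e).

Variables (k : nat).
Variable f : ('I_k -> nat) -> sumE (fun n => X n : normedModType R) e.
Hypothesis f_lip : lipschitz_H d f.

Definition fcoord (i : nat) (n : 'I_k -> nat) : X i := proj1_sig (f n) i.

Lemma cvE_fcoord n : cvE e (fun i => `|fcoord i n|).
Proof. by case: (f n) => x; rewrite /in_sumE /= => xE; rewrite /fcoord; case: (f n). Qed.
Arguments cvE_fcoord : clear implicits.

Lemma sumE_distE n m : d (f n) (f m) = nrE e (fun i => `|fcoord i n - fcoord i m|).
Proof. by []. Qed.

Lemma cvE_fcoord_diff n m : cvE e (fun i => `|fcoord i n - fcoord i m|).
Proof.
apply: (cvE_solid ue _ (cvE_add (cvE_fcoord n) (cvE_fcoord m))) => i.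
by rewrite normr_id [leRHS]ger0_norm ?addr_ge0// ler_normB.
Qed.
Arguments cvE_fcoord_diff : clear implicits.

Lemma fcoord_le i n m : `|fcoord i n - fcoord i m| <= d (f n) (f m).
Proof. by rewrite sumE_distE -[leLHS]normr_id; exact: (coord_le ue ne i (cvE_fcoord_diff n m)). Qed.

Lemma sumE_dist_ge0 x y : 0 <= d x y. Proof. exact: normr_ge0. Qed.

Lemma sumE_dist_triangle n m q : d (f n) (f q) <= d (f n) (f m) + d (f m) (f q).
Proof.
rewrite !sumE_distE; apply: le_trans (nrE_add (cvE_fcoord_diff n m) (cvE_fcoord_diff m q)).
apply: (nrE_solid ue) => [i|]; last exact: cvE_add (cvE_fcoord_diff n m) (cvE_fcoord_diff m q).
rewrite normr_id [leRHS]ger0_norm ?addr_ge0//.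
by rewrite -(subrKA (fcoord i m)) ler_normD.
Qed.

Lemma lipschitz_ge0 : exists2 L, 0 <= L & forall n m, incr n -> incr m ->
  d (f n) (f m) <= L * (dH n m)%:R.
Proof.
have [L HL] := f_lip; exists `|L| => // n m ni mi.
by apply: le_trans (HL n m _ _) _; rewrite ?ler_wpM2r ?ler_norm.
Qed.

Local Notation al := (alpha_nat d f).

Lemma pnorm_alpha_nat : pnorm p k al = (\sum_(j < k) alpha d f j `^ p) `^ p^-1.
Proof. by rewrite /pnorm; congr powR; apply: eq_bigr => j _; rewrite alpha_natE. Qed.

Lemma sumE_dist_bounded : exists C, forall n m, incr n -> incr m -> d (f n) (f m) <= C.
Proof.
have [L L0 HL] := lipschitz_ge0; exists (L * k%:R) => n m ni mi.
by apply: le_trans (HL _ _ ni mi) _; rewrite ler_wpM2l ?ler_nat ?dH_le.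
Qed.

Lemma sumE_dist_le_alpha (j : 'I_k) n m : H_pair setT j n m -> d (f n) (f m) <= al j.
Proof. by have [C HC] := sumE_dist_bounded; rewrite alpha_natE; exact: (alpha_ge HC). Qed.

Lemma alpha_nat_ge0 j : 0 <= al j.
Proof.
rewrite /alpha_nat; case: insubP => // i _ _; have [C HC] := sumE_dist_bounded.
exact: (alpha_ge0 _ sumE_dist_ge0 HC).
Qed.

(** The errors of the general argument are proportional to the power sum, so its vanishing is
    settled apart: all moduli are zero, and passing from [m] to [n] one entry at a time costs
    nothing. *)
Lemma sumE_dist_interlaced0 n m : pnorm p k al = 0 -> interlaced setT n m -> d (f n) (f m) <= 0.
Proof.
move=> S0 [[ni _] [[mi _] [nm mn]]].
have p0 : 0 < p by exact: lt_trans ltr01 p1.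
have a0 (j : 'I_k) : al j = 0.
  apply/eqP; rewrite -[al j](powRK p1) ?alpha_nat_ge0// eq_le powR_ge0 andbT -S0.
  apply: ler_powR_nneg; rewrite ?powR_ge0 ?invr_ge0 ?(ltW p0)//.
  by rewrite (bigD1 j)//= lerDl sumr_ge0// => i _; exact: powR_ge0.
pose x (j : nat) (q : 'I_k) := if (q < j)%N then n q else m q.
have xi j : incr (x j).
  move=> a b ab; rewrite /x; have [bj|jb] := ltnP b j.
    by rewrite (ltn_trans ab bj); exact: ni.
  case: ifP => _; last exact: mi.
  by apply: leq_trans (nm a) _; apply: ltnW; exact: mi.
suff H j : (j <= k)%N -> d (f (x j)) (f m) <= 0.
  have -> : n = x k by apply/funext => q; rewrite /x ltn_ord.
  exact: H.
elim: j => [_|j IH jk].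
  have -> : x 0%N = m by apply/funext => q.
  rewrite sumE_distE; have [|_ H] := @lmE_fin _ _ e (fun i => `|fcoord i m - fcoord i m|) 0.
    by move=> i _; rewrite subrr normr0.
  by rewrite /nrE H /psum big_ord0 normr0.
apply: le_trans (sumE_dist_triangle _ (x j) _) _; rewrite -[leRHS]addr0.
apply: lerD; last exact: IH (ltnW jk).
rewrite -(a0 (Ordinal jk)); apply: sumE_dist_le_alpha.
split; first by split.
split; first by split.
split=> [i|]; rewrite /x /= ?ltnSn ?ltnn//.
by rewrite -val_eqE /= ltnS leq_eqVlt => /negPf ->.
Qed.

(* Lipschitz maps are controlled on increasing tuples only; precomposing with
   this map makes all bounds unconditional. *)
Definition incr_or_id (n : 'I_k -> nat) : 'I_k -> nat := if `[< incr n >] then n else (fun i => i).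

Lemma incr_or_id_incr n : incr n -> incr_or_id n = n.
Proof. by rewrite /incr_or_id => /asboolP ->. Qed.

Lemma incr_incr_or_id n : incr (incr_or_id n).
Proof. by rewrite /incr_or_id; case: asboolP => // _ i j. Qed.

Lemma tail_bound (delta : R) : 0 < delta -> exists n0 (phi : nat -> nat),
  {homo phi : i j / (i < j)%N} /\ forall n, incr n ->
    nrE e (tail_part n0 (fun i => `|fcoord i (phi \o n)|)) <= pnorm p k al + delta.
Proof.
move=> delta0.
have [U [UU Uoo]] := ultraFilterLemma (F := \oo) _.
pose G s i := `|fcoord i (incr_or_id (tuple_of_seq s))|.
have [C HC] := sumE_dist_bounded.
(* [C] bounds only the oscillation of [f]; the norm at one reference list turns it into a bound on
   [G]. *)
have GC s : cvE e (G s) /\ nrE e (G s) <= C + nrE e (G [::]).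
  split; first exact: cvE_fcoord.
  have s0C := HC _ _ (incr_incr_or_id (tuple_of_seq s))
    (incr_incr_or_id (tuple_of_seq [::])).
  apply: le_trans (lerD s0C (lexx _)).
  rewrite sumE_distE; apply: le_trans (nrE_add (cvE_fcoord_diff _ _) (cvE_fcoord _)).
  apply: (nrE_solid ue) => [i|]; last by apply: cvE_add; [exact: cvE_fcoord_diff|exact: cvE_fcoord].
  rewrite normr_id [leRHS]ger0_norm ?addr_ge0//.
  by rewrite -{1}[fcoord i _](subrK (fcoord i (incr_or_id (tuple_of_seq [::])))) ler_normD.
have Gal j s s' : (j < k)%N -> sorted ltn s -> sorted ltn s' ->
  size s = k -> size s' = k -> (forall i, i != j -> nth 0%N s i = nth 0%N s' i) ->
  (nth 0 s j < nth 0 s' j)%N -> nrE e (fun i => G s i - G s' i) <= al j.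
  move=> jk so so' sk sk' nj lj.
  have is1 := incr_tuple_of_seq so sk; have is2 := incr_tuple_of_seq so' sk'.
  have H : H_pair setT (Ordinal jk) (tuple_of_seq s) (tuple_of_seq s').
    split; first by split.
    split; first by split.
    by split=> // i ij; apply: nj.
  apply: le_trans (sumE_dist_le_alpha H); rewrite sumE_distE.
  apply: (nrE_solid ue) => [i|]; last exact: cvE_fcoord_diff.
  by rewrite /G !incr_or_id_incr// normr_id ler_dist_dist.
have [n0 [phi [phi_lt Hphi]]] :=
  tail_concentration p1 ue ne pe re UU Uoo GC Gal delta0.
exists n0, phi; split=> // n ni.
have := Hphi _ (sorted_seq_of_tuple ni) (size_seq_of_tuple n); rewrite -seq_of_tuple_comp.
by rewrite /G seq_of_tupleK incr_or_id_incr//; exact: incr_comp.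
Qed.

Lemma head_bound (phi : nat -> nat) (n0 : nat) (delta : R) : 0 < delta ->
  {homo phi : i j / (i < j)%N} ->
  exists chi : nat -> nat, {homo chi : i j / (i < j)%N} /\
    forall n m, interlaced setT n m ->
      nrE e (head_part n0 (fun i => `|fcoord i (phi \o (chi \o n)) -
        fcoord i (phi \o (chi \o m))|)) <=
        lambda * pnorm p k (fun j => al j + n0%:R * delta).
Proof.
move=> delta0 phi_lt.
have [U [UU Uoo]] := ultraFilterLemma (F := \oo) _.
pose w (j : 'I_k) (i : nat) (s : seq nat) :=
  `|fcoord i (incr_or_id (phi \o del_nth j.+1 s)) - fcoord i (incr_or_id (phi \o del_nth j s))|.
have [C HC] := sumE_dist_bounded.
have wC (x : 'I_k * 'I_n0) s : `|w x.1 x.2 s| <= C.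
  by rewrite normr_id; apply: le_trans (fcoord_le _ _ _) _; apply: HC; exact: incr_incr_or_id.
(* Lists of length [k.+1] encode the pairs of every [H_pair], so one selection treats all [j < k]
   and [i < n0]. *)
have [psi [psi_lt Hpsi]] := Ramsey_bounded UU Uoo k.+1 delta0 wC.
have pp_lt : {homo phi \o psi : i j / (i < j)%N} by move=> i j /psi_lt /phi_lt.
have wE j i s : sorted ltn s -> size s = k.+1 -> w j i (map psi s) =
    `|fcoord i ((phi \o psi) \o del_nth j.+1 s) - fcoord i ((phi \o psi) \o del_nth j s)|.
  move=> so sk; have [[i1 _] [[i2 _] _]] := H_pair_del_nth j so sk.
  have delE h : (h <= k)%N -> phi \o (del_nth h (map psi s) : 'I_k -> nat) =
      (phi \o psi) \o del_nth h s.
    move=> hk; apply/funext => q; rewrite /= /del_nth (nth_map 0%N)//.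
    by rewrite sk /bump; have := ltn_ord q; lia.
  rewrite /w !delE ?(ltnW (ltn_ord j))// !incr_or_id_incr//; exact: incr_comp.
pose s0 := iota 0 k.+1.
have so0 : sorted ltn s0 by exact: iota_ltn_sorted.
have sk0 : size s0 = k.+1 by rewrite size_iota.
(* For each [j], a single pair coming from [s0] serves all coordinates [i]. This bounds the norm of
   the head of [b^~ j] by [al j + n0 * delta]; suprema taken separately in each coordinate need not
   satisfy such a bound. *)
pose b (i : nat) (j : 'I_k) := w j i (map psi s0) + delta.
have b0 i j : 0 <= b i j by rewrite addr_ge0 ?normr_ge0 ?ltW.
have [L _ HL] := lipschitz_ge0.
have [||chi [chi_lt Hchi]] := HIC_subsequence_finite (X := fun i => X i : normedModType R)
    (g := fcoord) (L := L) (b := b) (N := n0) p1 lambda0 hX _ pp_lt.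
- by move=> i n m ni mi; apply: le_trans (fcoord_le _ _ _) _; exact: HL.
- move=> i j n m iN /H_pair_del_nthP[s [so sk <- <-]].
  rewrite -wE// -lerBlDl; apply: le_trans (ler_norm _) _.
  exact: (Hpsi (j, Ordinal iN)).
exists (psi \o chi); split=> [i j /chi_lt/psi_lt//|n m nm].
pose c (j : 'I_k) : nat -> R := head_part n0 (b^~ j).
pose y i := (\sum_(j < k) `|c j i| `^ p) `^ p^-1.
have p0 : 0 < p by exact: lt_trans ltr01 p1.
have [yE _] : cvE e y /\ lmE e y = psum e y n0.
  apply: lmE_fin => i ni; rewrite /y big1 ?powR0 ?invr_eq0 ?gt_eqF// => j _.
  by rewrite /c head_part_fin// normr0 powR0 ?gt_eqF.
have [lyE ly] := lmE_scale lambda yE.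
apply: (@le_trans _ _ (nrE e (fun i => lambda * y i))).
  apply: (nrE_solid ue) => // i; rewrite /head_part; case: ifP => iN; last by rewrite normr0.
  rewrite normr_id [leRHS]ger0_norm; last by rewrite mulr_ge0 ?powR_ge0 ?ltW.
  have -> : y i = (\sum_(j < k) b i j `^ p) `^ p^-1.
    congr (_ `^ _); apply: eq_bigr => j _.
    by rewrite /c /head_part iN ger0_norm.
  exact: (Hchi i n m iN nm).
rewrite {1}/nrE ly normrZ gtr0_norm//; apply: ler_wpM2l; first exact: ltW.
have cE j : cvE e (c j) by exact: cvE_head_part.
(* [p]-convexity exchanges the [l_p] sum over [j] with the norm of [E]. *)
apply: le_trans (nrE_pconvex p1 pe cE yE) _.
apply: ler_powR_nneg; rewrite ?invr_ge0 ?(ltW p0)//.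
  by rewrite sumr_ge0// => j _; exact: powR_ge0.
apply: ler_sum => j _; apply: ler_powR_nneg; rewrite ?nrE_ge0 ?(ltW p0)//.
have cdE : c j =
    fun i => head_part n0 (fun i => w j i (map psi s0)) i + head_part n0 (fun=> delta) i.
  by apply/funext => i; rewrite /c /b /head_part; case: ifP; rewrite ?addr0.
rewrite cdE; apply: le_trans (nrE_add (@cvE_head_part _ _ e n0 _) (@cvE_head_part _ _ e n0 _)) _.
have Hj := H_pair_comp pp_lt (H_pair_del_nth j so0 sk0).
apply: lerD.
  apply: le_trans (sumE_dist_le_alpha Hj); rewrite sumE_distE.
  apply: le_trans (nrE_head_part ue n0 (cvE_fcoord_diff _ _)).
  apply: (nrE_solid ue) => [i|]; last exact: cvE_head_part.
  by rewrite /head_part; case: ifP => // _; rewrite wE.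
apply: le_trans (nrE_head_part_le ne _ _) _.
by rewrite sumr_const card_ord mulr_natl ger0_norm ?(ltW delta0).
Qed.

Lemma HIC_sum_function (eps : R) : 0 < eps -> exists M : set nat, infinite_set M /\
  forall n m, interlaced M n m ->
    d (f n) (f m) <= (lambda + 2 + eps) *
      (\sum_(j < k) (alpha d f j) `^ p) `^ p^-1.
Proof.
move=> eps0; rewrite -pnorm_alpha_nat; set S := pnorm p k al.
have S0 : 0 <= S := pnorm_ge0 _ _ _.
have [SE|SN] := eqVneq S 0.
  exists setT; split; first exact: infinite_nat.
  by move=> n m nm; rewrite SE mulr0; exact: sumE_dist_interlaced0.
have {SN}S0 : 0 < S by rewrite lt_neqAle eq_sym SN.
(* The tails at [n] and at [m] together use half of the allowed error [eps * S]; the head gets the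
   other half. *)
have [|n0 [phi [phi_lt Hphi]]] := @tail_bound (eps * S / 4).
  by rewrite divr_gt0 ?mulr_gt0.
(* The head error [lambda * k * n0 * delta] is at most [D * delta]. Since [D] involves [n0], [delta]
   is chosen after the tail is settled; dividing by [D + 1] avoids a zero denominator. *)
pose D : R := lambda * (k%:R * (n0%:R + 1)).
have D0 : 0 <= D by rewrite !mulr_ge0 ?addr_ge0 ?(ltW lambda0).
pose delta := eps * S / 2 / (D + 1).
have delta0 : 0 < delta by rewrite !divr_gt0 ?mulr_gt0 ?ltr_wpDl.
have [chi [chi_lt Hchi]] := head_bound n0 delta0 phi_lt.
have pc_lt : {homo phi \o chi : i j / (i < j)%N} by move=> i j /chi_lt /phi_lt.
exists (range (phi \o chi)); split; first exact: infinite_range_homo.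
move=> _ _ /(interlaced_range pc_lt)[n [m [nm -> ->]]].
have [[ni _] [[mi _] _]] := nm.
have tn := Hphi _ (incr_comp chi_lt ni); have tm := Hphi _ (incr_comp chi_lt mi).
have hnm := Hchi _ _ nm.
rewrite sumE_distE; apply: le_trans (nrE_head_tail_part ue n0 (cvE_fcoord_diff _ _)) _.
have tnm : nrE e (tail_part n0 (fun i => `|fcoord i (phi \o (chi \o n)) -
    fcoord i (phi \o (chi \o m))|)) <=
    (S + eps * S / 4) + (S + eps * S / 4).
  apply: le_trans (lerD tn tm).
  have h1 := cvE_tail_part (n := n0) ue (cvE_fcoord (phi \o (chi \o n))).
  have h2 := cvE_tail_part (n := n0) ue (cvE_fcoord (phi \o (chi \o m))).
  apply: le_trans (nrE_add h1 h2).
  apply: (nrE_solid ue) => [i|]; last exact: cvE_add.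
  rewrite /tail_part; case: ifP => _; first by rewrite normr0 addr0 normr0.
  by rewrite normr_id [leRHS]ger0_norm ?addr_ge0// ler_normB.
have hS : lambda * pnorm p k (fun j => al j + n0%:R * delta) <= lambda * S + eps * S / 2.
  have nd0 : 0 <= n0%:R * delta by rewrite mulr_ge0 ?(ltW delta0).
  apply: le_trans (ler_wpM2l (ltW lambda0) (pnorm_add p1 k nd0 alpha_nat_ge0)) _.
  rewrite [leLHS]mulrDr; apply: lerD; first exact: lexx.
  have DD : (D + 1) * delta = eps * S / 2.
    by rewrite /delta mulrC divfK// gt_eqF// ltr_wpDl.
  have DnE : lambda * (k%:R * (n0%:R * delta)) = D * delta - lambda * k%:R * delta.
    by rewrite /D; ring.
  rewrite -DD DnE mulrDl mul1r; apply: lerD; first exact: lexx.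
  apply: (@le_trans _ _ 0); last exact: ltW.
  rewrite oppr_le0.
  exact: mulr_ge0 (mulr_ge0 (ltW lambda0) (ler0n _ _)) (ltW delta0).
have -> : (lambda + 2 + eps) * S =
  (lambda * S + eps * S / 2) + ((S + eps * S / 4) + (S + eps * S / 4)) by field.
exact: lerD (le_trans hnm hS) tnm.
Qed.

End SumConcentration.

Theorem theorem1p1 (R : realType) (p lambda : R)
  (X : nat -> completeNormedModType R) (E : completeNormedModType R)
  (e : nat -> E) :
  1 < p -> 0 < lambda ->
  (forall n, HIC p lambda (@normdist R (X n))) ->
  reflexive_space E ->
  normalized e -> one_unconditional_basis e -> p_convex1 p e ->
  forall eps : R, 0 < eps ->
    HIC p (lambda + 2 + eps) (@sumE_dist R (fun n => X n : normedModType R) E e).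
Proof.
move=> p1 lambda0 hX re ne ue pe eps eps0 k f f_lip.
exact: (HIC_sum_function p1 lambda0 hX re ne ue pe f_lip eps0).
Qed.
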